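(* Let $n\ge3$, $\lambda_1,\dots,\lambda_n\in\mathbb{C}$, and let \[\Gamma:\ \{1\}\sqcup\dots\sqcup\{n\}\stackrel{(I_1,J_1)}{\longrightarrow}\cdots\stackrel{(I_{n-1},J_{n-1})}{\longrightarrow}\{1,\dots,n\}\] be a coupling scheme, with associated change of variables $(x_1,\dots,x_n)\mapsto(x_{1\dots n},u_{I_1,J_1},\dots,u_{I_{n-1},J_{n-1}})$. Then, in the new variables, for every $k=1,\dots,n-1$ the operator $C'_{I_k\cup J_k}$ on $\mathbb{C}[x_1,\dots,x_n]$ is given by \[C'_{I_k\cup J_k}=\Phi^{\lambda_{I_k},\lambda_{J_k}}_{u_{I_k,J_k}}+\frac{2}{1-u_{I_k,J_k}}C'_{I_k}+\frac{2}{1+u_{I_k,J_k}}C'_{J_k}.\]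
   Context: Operators. $sl_2$ has generators $H,E,F$ with $[H,E]=2E$, $[H,F]=-2F$, $[E,F]=H$, and Casimir element $C=\frac{H^2+2H}{4}+FE\in U(sl_2)$. The algebra $U(sl_2)^{\otimes n}$ acts on $\mathbb{C}[x_1,\dots,x_n]$ (realising the tensor product $V_{\lambda_1}\otimes\dots\otimes V_{\lambda_n}$ of lowest-weight Verma modules), the $i$-th tensor factor acting by $H\mapsto\lambda_i+2x_i\partial_{x_i}$, $E\mapsto x_i$ (multiplication), $F\mapsto-x_i\partial_{x_i}^2-\lambda_i\partial_{x_i}$. For $I\subset\{1,\dots,n\}$, $\delta_I:U(sl_2)\to U(sl_2)^{\otimes n}$ is the algebra morphism sending $x\in sl_2$ to $\sum_{i\in I}1\otimes\cdots\otimes x\otimes\cdots\otimes1$ ($x$ in position $i$). Set $C_I=\delta_I(C)$, $\lambda_I=\sum_{i\in I}\lambda_i$ and $C'_I=C_I-\frac{\lambda_I(\lambda_I-2)}4$; these are identified with their actions on $\mathbb{C}[x_1,\dots,x_n]$. One has $C'_{\{i\}}=0$ for every $i$. Coupling schemes. Partitions of $\{1,\dots,n\}$ are written $K_1\sqcup\dots\sqcup K_m$ with $\min K_1<\dots<\min K_m$. A coupling step $(K_a,K_b)$, $a<b$, transforms such a partition into the one in which $K_a$ and $K_b$ are removed and replaced by their union $K_a\cup K_b$. A coupling scheme is a sequence of $n-1$ coupling steps $(I_1,J_1),\dots,(I_{n-1},J_{n-1})$ from $\{1\}\sqcup\dots\sqcup\{n\}$ to the trivial partition $\{1,\dots,n\}$.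 Variables. For $I\subset\{1,\dots,n\}$ put $x_I=\sum_{i\in I}x_i$, and for disjoint nonempty $I,J$ put $u_{I,J}=\frac{x_J-x_I}{x_I+x_J}$; $x_{1\dots n}=x_1+\dots+x_n$. The new coordinates attached to the scheme are $(x_{1\dots n},u_{I_1,J_1},\dots,u_{I_{n-1},J_{n-1}})$; partial derivatives with respect to one of them are taken with the others fixed. Jacobi operator: $\Phi^{\lambda,\lambda'}_u=(u^2-1)\partial_u^2+\bigl(\lambda-\lambda'+(\lambda+\lambda')u\bigr)\partial_u$. *)

(* Defs.v *)
From HB Require Import structures.
From mathcomp Require Import all_boot all_order all_algebra fraction.
From mathcomp Require Import reals complex ring.
From mathcomp Require Import mpoly.

Set Implicit Arguments.
Unset Strict Implicit.
Unset Printing Implicit Defensive.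

Import Order.TTheory GRing.Theory Num.Theory.
Local Open Scope ring_scope.

Notation "x %:F" := (@tofrac _ x) : ring_scope.

Section Operators.
Variables (C : numFieldType) (n : nat) (lam : 'I_n -> C).
Implicit Types (i : 'I_n) (I : {set 'I_n}) (p : {mpoly C[n]}).

Definition opH i p : {mpoly C[n]} := lam i *: p + 2 *: ('X_i * p^`M(i)).
Definition opE i p : {mpoly C[n]} := 'X_i * p.
Definition opF i p : {mpoly C[n]} := - ('X_i * p^`M(i)^`M(i)) - lam i *: p^`M(i).

(* If op i is the action of x in sl_2 on the i-th tensor factor, this is the
   action of delta_I(x). *)
Definition delta I (op : 'I_n -> {mpoly C[n]} -> {mpoly C[n]}) p
  : {mpoly C[n]} := \sum_(i in I) op i p.

(* The element (H^2 + 2H)/4 + FE evaluated at three operators H, E, F. *)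
Definition casimir (H E F : {mpoly C[n]} -> {mpoly C[n]}) p : {mpoly C[n]} :=
  4^-1 *: (H (H p) + 2 *: H p) + F (E p).

(* delta_I is an algebra morphism, so delta_I(C) is the Casimir expression in
   delta_I(H), delta_I(E), delta_I(F). *)
Definition casimir_of I : {mpoly C[n]} -> {mpoly C[n]} :=
  casimir (delta I opH) (delta I opE) (delta I opF).

Definition lam_of I : C := \sum_(i in I) lam i.

Definition casimir'_of I p : {mpoly C[n]} :=
  casimir_of I p - (lam_of I * (lam_of I - 2) / 4) *: p.

Lemma mderiv_X i : ('X_i : {mpoly C[n]})^`M(i) = 1.
Proof.
rewrite mderivX mnm1E eqxx scale1r (_ : _ - _ = 0)%MM ?mpolyX0 //.
by rewrite -[X in (X - _)%MM]addm0 addmC addmK.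
Qed.

Lemma opEF i p : opE i (opF i p) - opF i (opE i p) = opH i p.
Proof.
rewrite /opE /opF /opH !(mderivM, mderivD, mderiv_X, mul1r).
by rewrite -!mul_mpolyC (_ : 2%:MP = 2 :> {mpoly C[n]}) ?mpolyC_nat //; ring.
Qed.

Lemma opHE i p : opH i (opE i p) - opE i (opH i p) = 2 *: opE i p.
Proof.
rewrite /opE /opH mderivM mderiv_X.
by rewrite -!mul_mpolyC (_ : 2%:MP = 2 :> {mpoly C[n]}) ?mpolyC_nat //; ring.
Qed.

Lemma opHF i p : opH i (opF i p) - opF i (opH i p) = - 2 *: opF i p.
Proof.
rewrite /opH /opF !(mderivD, mderivN, mderivZ, mderivM, mderiv_X, mul1r).
by rewrite -!mul_mpolyC mpolyCN (_ : 2%:MP = 2 :> {mpoly C[n]}) ?mpolyC_nat //; ring.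
Qed.

End Operators.

Section Jacobi.
Variables (C : numFieldType) (m : nat).

Definition jacobi (l l' : C) (j : 'I_m) (P : {mpoly C[m]}) : {mpoly C[m]} :=
  ('X_j ^+ 2 - 1) * P^`M(j)^`M(j) + ((l - l')%:MP + (l + l') *: 'X_j) * P^`M(j).

End Jacobi.

Section CouplingScheme.
Variable n : nat.
Local Notation block := {set 'I_n}.
Implicit Types (K L : {set block}) (st : block * block) (s : seq (block * block)).

Definition min_block (A : block) : nat := \big[minn/n]_(i in A) (i : nat).

(* The blocks K_1, ..., K_m of a partition are numbered by increasing minimum,
   so a step (K_a, K_b) has a < b iff min K_a < min K_b. *)
Definition coupling_step K st : bool :=
  [&& st.1 \in K, st.2 \in K & (min_block st.1 < min_block st.2)%N].

Definition couple K st : {set block} :=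
  (st.1 :|: st.2) |: (K :\ st.1 :\ st.2).

Fixpoint couples K s L : bool :=
  if s is st :: s' then coupling_step K st && couples (couple K st) s' L
  else K == L.

Definition discrete_partition : {set block} := [set [set i] | i : 'I_n].

Definition coupling_scheme (G : (n.-1).-tuple (block * block)) : bool :=
  couples discrete_partition G [set [set: 'I_n]].

End CouplingScheme.

Section Variables.
Variables (C : numFieldType) (n : nat).
Local Notation block := {set 'I_n}.
Implicit Types (I J : block) (G : (n.-1).-tuple (block * block)).

Definition xsum I : {mpoly C[n]} := \sum_(i in I) 'X_i.

Definition uvar I J : {fraction {mpoly C[n]}} :=
  (xsum J - xsum I)%:F / (xsum I + xsum J)%:F.

(* The n new coordinates are indexed by 'I_(n.-1).+1: index ord0 is the total
   sum of the x_i, index lift ord0 k is the variable u of the k-th step. *)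
Definition new_coord G (j : 'I_(n.-1).+1) : {fraction {mpoly C[n]}} :=
  if unlift ord0 j is Some k then uvar (tnth G k).1 (tnth G k).2
  else (xsum [set: 'I_n])%:F.

Definition at_new_coord G (P : {mpoly C[(n.-1).+1]})
  : {fraction {mpoly C[n]}} :=
  mmap (fun c : C => (c%:MP_[n])%:F) (new_coord G) P.

(* p = P(x_{1..n}, u_1, ..., u_{n-1}) as rational functions of the x_i.  The
   partial derivative of p with respect to a new variable, the others being
   fixed, is then that of P.  For a coupling scheme the x_i are polynomials in
   the new variables, so every p has such a P: see expressed_as_exists. *)
Definition expressed_as G (p : {mpoly C[n]}) (P : {mpoly C[(n.-1).+1]}) : Prop :=
  p%:F = at_new_coord G P.

End Variables.

Section ExistsExpression.
Variables (C : numFieldType) (n : nat).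
Local Notation block := {set 'I_n}.

Lemma partition_couple (K : {set block}) st :
  partition K [set: 'I_n] -> coupling_step K st ->
  [/\ partition (couple K st) [set: 'I_n], [disjoint st.1 & st.2]
    & st.1 :|: st.2 != set0].
Proof.
case: st => A B /= /and3P[/eqP covK triK nK] /and3P[/= AK BK ltAB].
have nAB : A != B by apply: contraTneq ltAB => ->; rewrite ltnn.
have dAB : [disjoint A & B] by move/trivIsetP: triK; apply.
have nU : A :|: B != set0.
  apply: contraNneq nK => U0.
  by rewrite -(_ : A = set0) //; apply/eqP; rewrite -subset0 -U0 subsetUl.
have BKA : B \in K :\ A by rewrite !inE eq_sym nAB.
split=> //; rewrite /couple /=.
apply/and3P; split.
- apply/eqP; rewrite -covK [in RHS](_ : K = A |: (B |: (K :\ A :\ B))).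
    by rewrite /cover !bigcup_setU !big_set1 setUA.
  by rewrite setD1K // setD1K.
- apply/trivIsetP => X Y; move/trivIsetP: triK => tri.
  have dU Z : Z \in K :\ A :\ B -> [disjoint A :|: B & Z].
    rewrite !inE => /and3P[ZB ZA ZK].
    rewrite -setI_eq0 setIUl setU_eq0 !setI_eq0.
    by rewrite !tri // eq_sym.
  case/setU1P=> [->|XK] /setU1P[->|YK].
  + by rewrite eqxx.
  + by move=> _; exact: dU.
  + by rewrite disjoint_sym => _; exact: dU.
  + by move: XK YK; rewrite !inE => /and3P[_ _ XK] /and3P[_ _ YK]; exact: tri.
- by rewrite !inE eq_sym (negPf nU) (negPf nK) !andbF.
Qed.

Lemma partition_discrete : partition (discrete_partition n) [set: 'I_n].
Proof.
apply/and3P; split.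
- apply/eqP/setP=> i; rewrite inE; apply/bigcupP; exists [set i].
    by apply/imsetP; exists i.
  exact/set11.
- apply/trivIsetP=> _ _ /imsetP[i _ ->] /imsetP[j _ ->] neq.
  by rewrite disjoints1 inE; apply: contraNneq neq => ->.
- by apply/negP=> /imsetP[i _ /setP/(_ i)]; rewrite !inE eqxx.
Qed.

Lemma xsum_neq0 (A : block) : A != set0 -> xsum C A != 0.
Proof.
case/set0Pn=> i iA; apply/eqP=> /(congr1 (fun p => p@_U_(i)%MM)).
rewrite mcoeff0 /xsum raddf_sum /= (bigD1 i) //= mcoeffX eqxx big1 ?addr0.
  by move/eqP; rewrite oner_eq0.
move=> j /andP[_ ji]; rewrite mcoeffX.
case: eqP => // /(congr1 (fun m : 'X_{1..n} => m j)).
by rewrite !mnm1E eqxx eq_sym (negPf ji).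
Qed.

Lemma couples_ind (Q : block -> Prop) (K : {set block}) s :
  partition K [set: 'I_n] -> couples K s [set [set: 'I_n]] ->
  Q [set: 'I_n] ->
  (forall A B, (A, B) \in s -> [disjoint A & B] -> A :|: B != set0 ->
     Q (A :|: B) -> Q A /\ Q B) ->
  forall A, A \in K -> Q A.
Proof.
elim: s K => [|[A B] s IHs] K partK /=.
  by move/eqP=> -> QT _ A; rewrite inE => /eqP ->.
case/andP=> stK cpl QT Qst D DK.
have [partK' dAB nU] := partition_couple partK stK.
have {}IHs := IHs _ partK' cpl QT
  (fun A B sAB => Qst A B (mem_behead (s := _ :: s) sAB)).
have [QA QB] := Qst A B (mem_head _ _) dAB nU (IHs _ (setU11 _ _)).
have [->//|nDA] := eqVneq D A; have [->//|nDB] := eqVneq D B.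
by apply: IHs; rewrite !inE nDA nDB DK orbT.
Qed.

Lemma half_split (F : fieldType) (a b : F) : 2 != 0 :> F -> a + b != 0 ->
  2^-1 * (a + b) * (1 - (b - a) / (a + b)) = a /\
  2^-1 * (a + b) * (1 + (b - a) / (a + b)) = b.
Proof. by move=> nz2 nz; split; field; rewrite nz nz2. Qed.

Variable G : (n.-1).-tuple (block * block).

Let constF : {rmorphism C -> {fraction {mpoly C[n]}}} :=
  (@tofrac _ \o (@mpolyC n C))%FUN.

Lemma expressed_as_exists (p : {mpoly C[n]}) :
  coupling_scheme G -> exists P, expressed_as G p P.
Proof.
move=> schG.
pose nc := new_coord C G; pose ev := mmap constF nc.
have evM : {morph ev : x y / x * y} by move=> x y; rewrite /ev rmorphM.
have evD : {morph ev : x y / x + y} by move=> x y; rewrite /ev rmorphD.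
have evB : {morph ev : x y / x - y} by move=> x y; rewrite /ev rmorphB.
have ev1 : ev 1 = 1 by rewrite /ev -mpolyC1 mmapC /= tofrac1.
pose Q A := exists P, (xsum C A)%:F = ev P.
have Qx : forall A, A \in discrete_partition n -> Q A.
  apply: (couples_ind (Q := Q) partition_discrete schG).
    rewrite /Q; exists 'X_ord0; rewrite /ev mmapX mmap1U /nc /new_coord.
    by rewrite unlift_none.
  move=> A B /tnthP[k ABk] dAB nU [P eqP].
  have xD : xsum C (A :|: B) = xsum C A + xsum C B.
    by rewrite /xsum -bigU //=; apply: eq_bigl => i; rewrite !inE.
  have nzF : (xsum C A + xsum C B)%:F != 0.
    by rewrite tofrac_eq0 -xD xsum_neq0.
  have evk : ev 'X_(lift ord0 k) = uvar C A B.
    by rewrite /ev mmapX mmap1U /nc /new_coord liftK -ABk.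
  have ev2 : ev (2^-1)%:MP = (2^-1 : C)%:MP%:F by rewrite /ev mmapC.
  have two : ((2^-1 : C)%:MP_[n])%:F = 2^-1 :> {fraction {mpoly C[n]}}.
    rewrite -[LHS]/(constF 2^-1) fmorphV; congr (_^-1).
    by rewrite rmorph_nat.
  have nz2 : (2 : {fraction {mpoly C[n]}}) != 0.
    rewrite -(rmorph_nat constF 2) fmorph_eq0.
    by rewrite pnatr_eq0.
  rewrite xD tofracD in eqP; rewrite tofracD in nzF.
  have [eqA eqB] := half_split nz2 nzF.
  rewrite /uvar tofracB tofracD in evk.
  rewrite /Q; split.
  - exists ((2^-1)%:MP * P * (1 - 'X_(lift ord0 k))).
    by rewrite !evM evB ev1 evk ev2 two -eqP eqA.
  - exists ((2^-1)%:MP * P * (1 + 'X_(lift ord0 k))).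
    by rewrite !evM evD ev1 evk ev2 two -eqP eqB.
suff : exists P, p%:F = ev P by [].
have QX i : exists P, ('X_i : {mpoly C[n]})%:F = ev P.
  have [P] : Q [set i] by apply: Qx; apply/imsetP; exists i.
  by rewrite /xsum big_set1; exists P.
elim/mpolyind: p => [|c m p _ _ [P eqP]].
  by exists 0; rewrite /ev mmap0 tofrac0.
suff [M eqM] : exists M, ('X_[m] : {mpoly C[n]})%:F = ev M.
  exists (c%:MP * M + P).
  by rewrite -mul_mpolyC tofracD tofracM eqM eqP evD evM [ev c%:MP]mmapC.
rewrite mpolyXE_id rmorph_prod.
elim/big_ind: _ => [|x y [X ->] [Y ->]|i _].
- by exists 1; rewrite ev1.
- by exists (X * Y); rewrite evM.
- have [X eqX] := QX i; exists (X ^+ m i).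
  by rewrite rmorphXn /= eqX /ev rmorphXn.
Qed.

End ExistsExpression.

(* Main.v *)
Require Import Defs.
From HB Require Import structures.
From mathcomp Require Import all_boot all_order all_algebra fraction.
From mathcomp Require Import reals complex ring.
From mathcomp Require Import mpoly.

Set Implicit Arguments.
Unset Strict Implicit.
Unset Printing Implicit Defensive.
Import GRing.Theory Num.Theory.
Local Open Scope ring_scope.

(* Let D_I be the Euler operator sum_(i in I) x_i d/dx_i.  Expanding the
   Casimir expression gives
     C'_I = D_I^2 + (lam_I - 1) D_I + x_I delta_I(F),
   and delta_I(F) is additive over disjoint blocks.
   Put s = x_I + x_J for a step (I, J) of the scheme.  Because the blocks of
   the scheme are nested, d/du_{I,J} rescales the x_i inside I, rescales those
   inside J the other way, and fixes s and the remaining x_i, so that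
     d/du_{I,J} = - s / (2 x_I) D_I + s / (2 x_J) D_J.
   This derivation of the field of rational functions takes the value 1 on
   u_{I,J} and 0 on all the other new coordinates; by the chain rule it then
   computes the partial derivative of every polynomial in the new variables,
   with no need for their algebraic independence.  Substituting it into the
   Jacobi operator turns the claim into an identity in a field. *)

(** * Extension of a derivation from an integral domain to its field of fractions *)

Section FractionDerivation.
Variables (R : idomainType) (d : R -> {fraction R}).
Hypothesis dD : {morph d : p q / p + q}.
Hypothesis dM : forall p q, d (p * q) = d p * q%:F + p%:F * d q.
Implicit Types (p q : R) (f g : {fraction R}).

Local Open Scope quotient_scope.

Lemma frac_numden f : f = (\n_(repr f))%:F / (\d_(repr f))%:F.
Proof.
have nz : (\d_(repr f))%:F != 0 :> {fraction R}.
  by rewrite tofrac_eq0 denom_ratioP.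
apply: (canRL (mulfK nz)); rewrite -{1}[f]reprK.
set x := repr f.
(* Unlocking the embedding exhibits an element of [R] as the class of a ratio with denominator 1, so
   the claim reduces to a cross-multiplication of ratios. *)
have -> : (\d_x)%:F = \pi_({fraction R}) (Ratio \d_x 1).
  by unlock FracField.tofrac.
have -> : (\n_x)%:F = \pi_({fraction R}) (Ratio \n_x 1).
  by unlock FracField.tofrac.
rewrite /GRing.mul /= -FracField.pi_mul; apply/eqP.
rewrite FracField.equivf_def /FracField.mulf.
by rewrite !numden_Ratio ?(mulf_neq0, oner_neq0, denom_ratioP) // !mulr1 mulrC.
Qed.

(** Quotient rule in the form (dp - f dq)/q, taken at the chosen representative p/q of f;
    [frac_derE] removes the dependence on that choice. *)
Definition frac_der f : {fraction R} :=
  (d \n_(repr f) - f * d \d_(repr f)) / (\d_(repr f))%:F.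

(** If p/q = p'/q' = f, applying d to p q' = p' q and substituting p = f q, p' = f q' gives (dp - f
    dq) q' = (dp' - f dq') q. *)
Lemma frac_derE f p q : q != 0 -> f * q%:F = p%:F ->
  frac_der f * q%:F = d p - f * d q.
Proof.
move=> nzq fq; rewrite /frac_der.
have := denom_ratioP (repr f); have := frac_numden f.
move: (\n_(repr f)) (\d_(repr f)) => p' q' ef nzq'.
have nzF' : q'%:F != 0 :> {fraction R} by rewrite tofrac_eq0.
have fq' : f * q'%:F = p'%:F by rewrite ef divfK.
have epq : p * q' = p' * q.
  by apply/eqP; rewrite -tofrac_eq !tofracM -fq -fq' mulrAC.
have /eqP := congr1 d epq; rewrite !dM -fq -fq' -subr_eq0 => /eqP e.
apply: (mulIf nzF'); rewrite mulrAC divfK //.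
by apply/eqP; rewrite -subr_eq0 -oppr_eq0 -e; apply/eqP; ring.
Qed.

Lemma frac_der_tofrac p : frac_der p%:F = d p.
Proof.
have d1 : d 1 = 0.
  by apply: (addrI (d 1)); rewrite addr0 -{3}[1]mulr1 dM tofrac1 mulr1 mul1r.
have := @frac_derE p%:F p 1 (oner_neq0 R).
by rewrite d1 tofrac1 !mulr1 mulr0 subr0 => ->.
Qed.

Lemma frac_fraction f : exists p q, q != 0 /\ f * q%:F = p%:F.
Proof.
exists (\n_(repr f)), (\d_(repr f)); split; first exact: denom_ratioP.
by rewrite [X in X * _]frac_numden divfK // tofrac_eq0 denom_ratioP.
Qed.

(** Over the common denominator q q', [frac_derE] reduces the claim to the additivity and Leibniz
    rule of d on [R]. *)
Lemma frac_derD : {morph frac_der : f g / f + g}.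
Proof.
move=> f g; have [p [q [nzq fq]]] := frac_fraction f.
have [p' [q' [nzq' gq']]] := frac_fraction g.
have nz : q * q' != 0 by rewrite mulf_neq0.
have nzF : (q * q')%:F != 0 :> {fraction R} by rewrite tofrac_eq0.
have s : (f + g) * (q * q')%:F = (p * q' + p' * q)%:F.
  by rewrite tofracD !tofracM -fq -gq'; ring.
apply: (mulIf nzF); rewrite (frac_derE nz s) tofracM.
have -> : (frac_der f + frac_der g) * (q%:F * q'%:F) =
  (frac_der f * q%:F) * q'%:F + (frac_der g * q'%:F) * q%:F by ring.
rewrite (frac_derE nzq fq) (frac_derE nzq' gq').
by rewrite dD !dM -fq -gq'; ring.
Qed.

Lemma frac_derM f g : frac_der (f * g) = frac_der f * g + f * frac_der g.
Proof.
have [p [q [nzq fq]]] := frac_fraction f.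
have [p' [q' [nzq' gq']]] := frac_fraction g.
have nz : q * q' != 0 by rewrite mulf_neq0.
have nzF : (q * q')%:F != 0 :> {fraction R} by rewrite tofrac_eq0.
have s : (f * g) * (q * q')%:F = (p * p')%:F.
  by rewrite !tofracM -fq -gq'; ring.
apply: (mulIf nzF); rewrite (frac_derE nz s) tofracM.
have -> : (frac_der f * g + f * frac_der g) * (q%:F * q'%:F) =
  (frac_der f * q%:F) * (g * q'%:F) + (frac_der g * q'%:F) * (f * q%:F) by ring.
rewrite (frac_derE nzq fq) (frac_derE nzq' gq').
by rewrite !dM -fq -gq'; ring.
Qed.

End FractionDerivation.

(** Chain rule: evaluation followed by [D], and [mderiv k] followed by evaluation, are both
    derivations along [mmap f h], so agreement on constants and variables propagates to all
    polynomials. *)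
Lemma mmap_mderiv (C K : comNzRingType) m (f : {rmorphism C -> K})
    (h : 'I_m -> K) (D : K -> K) (k : 'I_m) :
  {morph D : x y / x + y} -> (forall x y, D (x * y) = D x * y + x * D y) ->
  (forall c, D (f c) = 0) -> (forall j, D (h j) = (k == j)%:R) ->
  forall P, D (mmap f h P) = mmap f h P^`M(k).
Proof.
move=> DD DM Df Dh; elim/mpolyind => [|c mon P _ _ IH].
  by rewrite mderiv0 mmap0 -(rmorph0 f) Df rmorph0.
rewrite -mul_mpolyC mmapD DD mderivD mmapD IH; congr (_ + _).
rewrite mderiv_mulC !rmorphM /= DM mmapC Df mul0r add0r; congr (_ * _).
rewrite mpolyXE_id.
elim/big_ind: _ => [|x y ex ey|i _].
- by rewrite -mpolyC1 mderivC mmap0 mmapC Df.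
- by rewrite mderivM mmapD !rmorphM /= DM ex ey.
elim: (mon i) => [|e IHe].
  by rewrite expr0 -mpolyC1 mderivC mmap0 mmapC Df.
rewrite exprS mderivM mmapD !rmorphM /= DM IHe; congr (_ * _ + _).
rewrite mmapX mmap1U Dh mderivX mnm1E eq_sym.
case: eqVneq => [->|_]; last by rewrite scale0r mmap0.
rewrite scale1r (_ : _ - _ = 0)%MM ?mpolyX0 ?rmorph1 //.
by rewrite -[X in (X - _)%MM]addm0 addmC addmK.
Qed.

(** * Euler operators and the expansion of the Casimir element *)

Section Euler.
Variables (C : numFieldType) (n : nat) (lam : 'I_n -> C).
Implicit Types (I J : {set 'I_n}) (p q : {mpoly C[n]}).

Definition euler I p : {mpoly C[n]} := \sum_(i in I) 'X_i * p^`M(i).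

Lemma eulerD I : {morph euler I : p q / p + q}.
Proof.
move=> p q; rewrite -big_split; apply: eq_bigr => i _.
by rewrite mderivD mulrDr.
Qed.

Lemma eulerM I p q : euler I (p * q) = euler I p * q + p * euler I q.
Proof.
rewrite mulr_suml mulr_sumr -big_split; apply: eq_bigr => i _ /=.
by rewrite mderivM; ring.
Qed.

Lemma eulerC I c : euler I c%:MP = 0.
Proof. by apply: big1 => i _; rewrite mderivC mulr0. Qed.

Lemma mderiv_xsum i J : (xsum C J)^`M(i) = (i \in J)%:R.
Proof.
rewrite /xsum raddf_sum /=.
have dX j : ('X_j : {mpoly C[n]})^`M(i) = (j == i)%:R.
  have [->|ji] := eqVneq j i; first exact: mderiv_X.
  by rewrite mderivX mnm1E (negPf ji) scale0r.
have [iJ|iJ] := boolP (i \in J).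
  rewrite (bigD1 i) //= dX eqxx big1 ?addr0 // => j /andP[_ ji].
  by rewrite dX (negPf ji).
by apply: big1 => j jJ; rewrite dX; case: eqVneq jJ iJ => // -> ->.
Qed.

Lemma euler_xsum I J : euler I (xsum C J) = xsum C (I :&: J).
Proof.
rewrite /euler (bigID (mem J)) /= [X in _ + X]big1 ?addr0 => [|i /andP[_ iJ]].
  rewrite /xsum; apply: eq_big => i; first by rewrite inE.
  by case/andP=> _ iJ; rewrite mderiv_xsum iJ mulr1.
by rewrite mderiv_xsum (negPf iJ) mulr0.
Qed.

Lemma xsumU I J : [disjoint I & J] -> xsum C (I :|: J) = xsum C I + xsum C J.
Proof.
by move=> dIJ; rewrite /xsum -bigU //=; apply: eq_bigl => i; rewrite !inE.
Qed.

Lemma eulerU I J p :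
  [disjoint I & J] -> euler (I :|: J) p = euler I p + euler J p.
Proof.
by move=> dIJ; rewrite /euler -bigU //=; apply: eq_bigl => i; rewrite !inE.
Qed.

Lemma lam_ofU I J :
  [disjoint I & J] -> lam_of lam (I :|: J) = lam_of lam I + lam_of lam J.
Proof.
by move=> dIJ; rewrite /lam_of -bigU //=; apply: eq_bigl => i; rewrite !inE.
Qed.

Lemma deltaU I J op p : [disjoint I & J] ->
  delta (I :|: J) op p = delta I op p + delta J op p :> {mpoly C[n]}.
Proof.
by move=> dIJ; rewrite /delta -bigU //=; apply: eq_bigl => i; rewrite !inE.
Qed.

Lemma delta_opH I p :
  delta I (opH lam) p = lam_of lam I *: p + 2 *: euler I p.
Proof. by rewrite /delta big_split /= -scaler_suml -scaler_sumr. Qed.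

Lemma delta_opE I p : delta I (@opE C n) p = xsum C I * p.
Proof. by rewrite /xsum mulr_suml. Qed.

(** The relation FE = EF - H under [delta I], obtained factor by factor since x_I has partial
    derivative 1 in each x_i with i in I. *)
Lemma delta_opF_xsum I p :
  delta I (opF lam) (xsum C I * p) =
  xsum C I * delta I (opF lam) p - 2 *: euler I p - lam_of lam I *: p.
Proof.
rewrite /delta /lam_of /euler scaler_suml scaler_sumr mulr_sumr -!sumrB.
apply: eq_bigr => i iI; rewrite /opF.
have x1 : (xsum C I)^`M(i) = 1%:MP by rewrite mderiv_xsum iI mpolyC1.
rewrite !(mderivM, mderivD) x1 mderivC mpolyC1 -!mul_mpolyC.
by rewrite (_ : 2%:MP = 2 :> {mpoly C[n]}) ?mpolyC_nat //; ring.
Qed.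

(** With H = lam_I + 2 D_I, the term (H^2 + 2H)/4 is D_I^2 + (lam_I + 1) D_I plus a constant;
    rewriting FE as EF - H subtracts 2 D_I + lam_I, and the shift defining C'_I cancels the
    remaining constant. *)
Lemma casimir'_euler I p :
  casimir'_of lam I p = euler I (euler I p) +
    (lam_of lam I - 1)%:MP * euler I p + xsum C I * delta I (opF lam) p.
Proof.
rewrite /casimir'_of /casimir_of /casimir delta_opE delta_opF_xsum !delta_opH.
rewrite -!mul_mpolyC !(eulerD, eulerM, eulerC).
set l := lam_of lam I; set e := euler I p; set F := delta _ _ _.
have -> : (l * (l - 2) / 4)%:MP_[n] = l%:MP * (l%:MP - 2) * (4^-1)%:MP.
  by rewrite !mpolyCM mpolyCB mpolyC_nat.
have h4 : (4^-1)%:MP_[n] * 4 = 1 :> {mpoly C[n]}.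
  by rewrite -(mpolyC_nat n C 4) -mpolyCM mulVf ?mpolyC1 ?pnatr_eq0.
rewrite mpolyCB mpolyC1 !mul0r !add0r.
rewrite (_ : 2%:MP = 2 :> {mpoly C[n]}) ?mpolyC_nat //.
move: h4; set c := (4^-1)%:MP => h4; apply/eqP; rewrite -subr_eq0.
(* Polynomials do not form a field, so 1/4 is kept as an opaque c with 4c = 1; the difference of the
   two sides is exactly this multiple of 4c - 1. *)
have -> : 0 = (c * 4 - 1) *
    (euler I e + l%:MP * e + e + l%:MP * p) :> {mpoly C[n]}.
  by rewrite h4 subrr mul0r.
by apply/eqP; ring.
Qed.

End Euler.

(** * Nestedness of the blocks of a coupling scheme *)

Section Blocks.
Variable n : nat.
Local Notation block := {set 'I_n}.
Implicit Types (K L M : {set block}) (A Z : block) (st : block * block).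
Implicit Types (s : seq (block * block)).

Lemma couples_cat K s1 s2 L : couples K (s1 ++ s2) L ->
  exists M, couples K s1 M /\ couples M s2 L.
Proof.
elim: s1 K => [|st s1 IH] K /=; first by exists K.
by case/andP=> stK /IH[M [c1 c2]]; exists M; rewrite stK.
Qed.

Lemma couples_partition K s M :
  partition K [set: 'I_n] -> couples K s M -> partition M [set: 'I_n].
Proof.
elim: s K => [|st s IH] K pK /=; first by move/eqP<-.
by case/andP=> /(partition_couple pK)[pK' _ _]; exact: IH.
Qed.

Lemma couple_coarser K st A :
  A \in K -> exists2 Z, Z \in couple K st & A \subset Z.
Proof.
move=> AK; rewrite /couple.
have [->|n1] := eqVneq A st.1.
  by exists (st.1 :|: st.2); rewrite ?setU11 ?subsetUl.
have [->|n2] := eqVneq A st.2.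
  by exists (st.1 :|: st.2); rewrite ?setU11 ?subsetUr.
by exists A; rewrite // !inE n1 n2 AK orbT.
Qed.

Lemma couples_coarser K s M A :
  couples K s M -> A \in K -> exists2 Z, Z \in M & A \subset Z.
Proof.
elim: s K A => [|st s IH] K A /=; first by move/eqP=> -> AM; exists A.
case/andP=> _ c /(couple_coarser st)[Z ZK AZ].
by have [Z' Z'M ZZ'] := IH _ _ c ZK; exists Z'; rewrite ?(subset_trans AZ).
Qed.

Lemma couples_earlier K s M st : couples K s M -> st \in s ->
  exists2 Z, Z \in M & st.1 :|: st.2 \subset Z.
Proof.
elim: s K => //= st' s IH K /andP[_ c].
rewrite inE => /orP[/eqP->|]; last exact: IH c.
exact: couples_coarser c (setU11 _ _).
Qed.

(** Coupling only enlarges blocks, so [A] lies in a single block of each later partition, and two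
    blocks of one partition are equal or disjoint. *)
Lemma couples_later K s M A st : partition K [set: 'I_n] -> couples K s M ->
  A \in K -> st \in s ->
  ((A \subset st.1) || [disjoint A & st.1]) &&
  ((A \subset st.2) || [disjoint A & st.2]).
Proof.
elim: s K A => //= st' s IH K A pK /andP[stK c] AK.
rewrite inE => /orP[/eqP->|sts].
  have /and3P[_ /trivIsetP tri _] := pK; case/and3P: stK => K1 K2 _.
  have sd B : B \in K -> (A \subset B) || [disjoint A & B].
    move=> BK; have [->|nAB] := eqVneq A B; first by rewrite subxx.
    by rewrite tri ?orbT.
  by rewrite !sd.
have [Z ZK AZ] := couple_coarser st' AK.
have [pK' _ _] := partition_couple pK stK.
have sd (B : block) :
    (Z \subset B) || [disjoint Z & B] -> (A \subset B) || [disjoint A & B].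
  case/orP=> [ZB|dZB]; first by rewrite (subset_trans AZ ZB).
  by rewrite (disjointWl AZ) ?orbT.
by case/andP: (IH _ _ pK' c ZK sts) => /sd -> /sd ->.
Qed.

Variables (G : (n.-1).-tuple (block * block)) (k : 'I_n.-1).
Hypothesis schG : coupling_scheme G.
Let I := (tnth G k).1.
Let J := (tnth G k).2.

(** [M] is the partition reached just before step [k]. *)
Let splitG : exists M, [/\ couples (discrete_partition n) (take k G) M,
  coupling_step M (tnth G k) &
  couples (couple M (tnth G k)) (drop k.+1 G) [set [set: 'I_n]]].
Proof.
have kG : (k < size G)%N by rewrite size_tuple.
move: schG; rewrite /coupling_scheme -{1}(cat_take_drop k G).
rewrite (drop_nth (tnth G k)) // -tnth_nth.
by case/couples_cat => M [c1] /andP[stM c2]; exists M.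
Qed.

Lemma scheme_blocks : [/\ [disjoint I & J], I != set0 & J != set0].
Proof.
have [M [c1 stM _]] := splitG.
have pM := couples_partition (partition_discrete n) c1.
have [_ dIJ _] := partition_couple pM stM.
have /and3P[_ _ nM] := pM; case/and3P: stM => IM JM _.
by split=> //; apply: contraNneq nM => <-.
Qed.

(** A step before [k] has its union inside one block of the partition preceding step [k]: this block
    is I, J, or disjoint from both. For a step after [k], I and J are already merged, so
    [couples_later] applies to their union. *)
Lemma scheme_laminar l : l != k ->
  let X := (tnth G l).1 in let Y := (tnth G l).2 in
  [\/ X :|: Y \subset I, X :|: Y \subset J |
    ((I :|: J \subset X) || [disjoint I :|: J & X]) &&
    ((I :|: J \subset Y) || [disjoint I :|: J & Y])].
Proof.
move=> lk X Y; have [M [c1 stM c2]] := splitG.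
have pM := couples_partition (partition_discrete n) c1.
have lG : (l < size G)%N by rewrite size_tuple.
have [ltlk|ltkl|/val_inj elk] := ltngtP l k; last by rewrite elk eqxx in lk.
  have lt : tnth G l \in take k G.
    rewrite (tnth_nth (tnth G k)) -(nth_take _ ltlk) mem_nth //.
    by rewrite size_take; case: ifP => // _.
  have [Z ZM XYZ] := couples_earlier c1 lt.
  have [<-|nZI] := eqVneq Z I; first by constructor 1.
  have [<-|nZJ] := eqVneq Z J; first by constructor 2.
  constructor 3; have /and3P[_ /trivIsetP tri _] := pM.
  case/and3P: stM => IM JM _.
  have dZ : [disjoint I :|: J & Z].
    rewrite -setI_eq0 setIUl setU_eq0 !setI_eq0.
    by rewrite (tri I Z) ?(tri J Z) // eq_sym.
  move: XYZ; rewrite subUset => /andP[XZ YZ].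
  by rewrite (disjointWr XZ dZ) (disjointWr YZ dZ) !orbT.
have lt : tnth G l \in drop k.+1 G.
  rewrite (tnth_nth (tnth G k)) -(subnKC ltkl) -nth_drop mem_nth //.
  by rewrite size_drop ltn_sub2r // (leq_ltn_trans ltkl).
constructor 3; have [pM' _ _] := partition_couple pM stM.
exact: couples_later pM' c2 (setU11 _ _) lt.
Qed.

End Blocks.

(** * Identities in a field with a derivation *)

Section FieldIdentity.
Variables (F : fieldType) (D : F -> F).
Hypothesis DD : {morph D : x y / x + y}.
Hypothesis DM : forall x y, D (x * y) = D x * y + x * D y.

(** The quotient u has degree 0 in two eigenvectors of common eigenvalue. Differentiating u (x + y)
    + x = y avoids a quotient rule for [D]. *)
Lemma der_eigenratio (c x y : F) : x + y != 0 -> D x = c * x -> D y = c * y ->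
  D ((y - x) / (x + y)) = 0.
Proof.
move=> nz Dx Dy; set u := _ / _.
have us : u * (x + y) + x = y by rewrite divfK // subrK.
apply: (mulIf nz); rewrite mul0r.
have : D (u * (x + y) + x) = c * (u * (x + y) + x) by rewrite us Dy.
rewrite !(DD, DM) Dx Dy => /eqP; rewrite -subr_eq0 => /eqP e.
by rewrite -e; ring.
Qed.

Lemma derN x : D (- x) = - D x.
Proof.
have D0 : D 0 = 0 by apply: (addrI (D 0)); rewrite -DD !addr0.
by apply/eqP; rewrite -addr_eq0 -DD addNr D0.
Qed.

(** Differentiating 2 c x = s with s constant gives (D c) x + c (D x) = 0. This serves for the
    coefficients [al] and [be], which are not constants of d/du_{I,J}. *)
Lemma der_eigenvalue (c x s : F) : 2 != 0 :> F -> x != 0 ->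
  2 * (c * x) = s -> D s = 0 -> D x = c * x -> D c = - c ^+ 2.
Proof.
move=> nz2 nzx <- Ds Dx; apply: (mulIf nzx); apply: (mulfI nz2).
move: Ds; rewrite mulr_natl DD DM Dx => /eqP; rewrite -subr_eq0 => /eqP e.
by apply/eqP; rewrite -subr_eq0 -e; apply/eqP; ring.
Qed.

(** The two equations make x + y a constant, so only the numerator varies: D (y - x) = be y - al x =
    x + y. *)
Lemma der_jacobi_variable (al be x y : F) : 2 != 0 :> F -> x + y != 0 ->
  D x = al * x -> D y = be * y ->
  2 * (al * x) = - (x + y) -> 2 * (be * y) = x + y ->
  D ((y - x) / (x + y)) = 1.
Proof.
move=> nz2 nz Dx Dy eal ebe; set u := _ / _.
have us : u * (x + y) + x = y by rewrite divfK // subrK.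
clearbody u.
have ab : al * x + be * y = 0.
  by apply: (mulfI nz2); rewrite mulrDr eal ebe addNr mulr0.
have e : D u * (x + y) + al * x = be * y.
  by rewrite -Dy -[in RHS]us DD DM DD Dx Dy ab mulr0 addr0.
have -> : D u = (be * y - al * x) / (x + y) by rewrite -e addrK mulfK.
have -> : be * y = (x + y) / 2 by rewrite -ebe [RHS]mulrC mulKf.
have -> : al * x = - (x + y) / 2 by rewrite -eal [RHS]mulrC mulKf.
by field; rewrite nz nz2.
Qed.

(** Here a = x_I, b = x_J, A = D_I p, B = D_J p, AB = D_I D_J p, BA = D_J D_I p, and FI, FJ are the
    actions of F. From 1 - u = 2a/s and 1 + u = 2b/s follows u^2 - 1 = -4ab/s^2; thus AB and BA get
    coefficient 1, AA gets -b/a + s/a = 1, and FI gets (s/a) a = s. *)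
Lemma jacobi_identity (a b al be l l' A B AA AB BA BB FI FJ : F) :
  2 != 0 :> F -> a != 0 -> b != 0 -> a + b != 0 ->
  2 * (al * a) = - (a + b) -> 2 * (be * b) = a + b ->
  let s := a + b in let u := (b - a) / s in
  AA + AB + (BA + BB) + (l + l' - 1) * (A + B) + s * (FI + FJ) =
  (u ^+ 2 - 1) * (- al ^+ 2 * A + al * (al * AA + be * BA) +
                  (- be ^+ 2 * B + be * (al * AB + be * BB)))
  + (l - l' + (l + l') * u) * (al * A + be * B)
  + 2 / (1 - u) * (AA + (l - 1) * A + a * FI)
  + 2 / (1 + u) * (BB + (l' - 1) * B + b * FJ).
Proof.
move=> nz2 nza nzb nzs eal ebe s u.
have -> : al = - s / (2 * a) by rewrite /s -eal; field; rewrite nza nz2.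
have -> : be = s / (2 * b) by rewrite /s -ebe; field; rewrite nzb nz2.
have -> : 2 / (1 - u) = s / a.
  have -> : 1 - u = 2 * a / s by rewrite /u /s; field.
  by rewrite /s; field; rewrite nza nzs.
have -> : 2 / (1 + u) = s / b.
  have -> : 1 + u = 2 * b / s by rewrite /u /s; field.
  by rewrite /s; field; rewrite nzb nzs.
by rewrite /u /s; field; rewrite nza nzb nzs nz2.
Qed.

Lemma jacobi_coefs (a b : F) : 2 != 0 :> F -> a != 0 -> b != 0 ->
  exists al be, 2 * (al * a) = - (a + b) /\ 2 * (be * b) = a + b.
Proof.
move=> nz2 nza nzb; exists (- (a + b) / (2 * a)), ((a + b) / (2 * b)).
by split; field; rewrite ?nza ?nzb nz2.
Qed.

End FieldIdentity.

Lemma frac_mpoly_two_neq0 (C : numFieldType) n :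
  2 != 0 :> {fraction {mpoly C[n]}}.
Proof.
rewrite -(rmorph_nat (@tofrac _)) tofrac_eq0.
by rewrite -mpolyC_nat mpolyC_eq0 pnatr_eq0.
Qed.

(** * The derivation d/du_{I,J} and its values on the new coordinates *)

Section JacobiVariable.
Variables (C : numFieldType) (n : nat) (I J : {set 'I_n}).
Hypotheses (dIJ : [disjoint I & J]) (nzI : I != set0) (nzJ : J != set0).
Local Notation K := {fraction {mpoly C[n]}}.
Implicit Types (p q : {mpoly C[n]}).

Local Notation a := (xsum C I)%:F.
Local Notation b := (xsum C J)%:F.

Lemma tofrac_xsumU (X Y : {set 'I_n}) : [disjoint X & Y] ->
  (xsum C (X :|: Y))%:F = (xsum C X)%:F + (xsum C Y)%:F :> K.
Proof. by move=> dXY; rewrite xsumU // tofracD. Qed.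

Let two0 := frac_mpoly_two_neq0 C n.
Let a0 : a != 0 :> K. Proof. by rewrite tofrac_eq0 xsum_neq0. Qed.
Let b0 : b != 0 :> K. Proof. by rewrite tofrac_eq0 xsum_neq0. Qed.

Let s0 : a + b != 0 :> K.
Proof.
rewrite -(tofrac_xsumU dIJ) tofrac_eq0 xsum_neq0 //.
by apply: contraNneq nzI => U0; rewrite -subset0 -U0 subsetUl.
Qed.

Variables al be : K.
Hypothesis ala2 : 2 * (al * a) = - (a + b).
Hypothesis beb2 : 2 * (be * b) = a + b.

Let alabe : al * a + be * b = 0.
Proof. by apply: (mulfI two0); rewrite mulrDr ala2 beb2 addNr mulr0. Qed.

(* The derivation d/du_{I,J}: al = - s / (2 x_I) and be = s / (2 x_J). *)
Definition dpoly p : K := al * (euler I p)%:F + be * (euler J p)%:F.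
Definition du : K -> K := frac_der dpoly.

Let dpolyD : {morph dpoly : p q / p + q}.
Proof. by move=> p q; rewrite /dpoly !eulerD !tofracD; ring. Qed.

Let dpolyM p q : dpoly (p * q) = dpoly p * q%:F + p%:F * dpoly q.
Proof. by rewrite /dpoly !eulerM !tofracD !tofracM; ring. Qed.

Lemma duD : {morph du : f g / f + g}. Proof. exact: frac_derD. Qed.

Lemma duM f g : du (f * g) = du f * g + f * du g.
Proof. exact: frac_derM. Qed.

Lemma du_tofrac p : du p%:F = al * (euler I p)%:F + be * (euler J p)%:F.
Proof. exact: frac_der_tofrac. Qed.

Lemma du_const c : du (c%:MP_[n])%:F = 0.
Proof. by rewrite du_tofrac !eulerC !tofrac0 !mulr0 addr0. Qed.

Let du_xsum X : du (xsum C X)%:F =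
  al * (xsum C (I :&: X))%:F + be * (xsum C (J :&: X))%:F.
Proof. by rewrite du_tofrac !euler_xsum. Qed.

Let xsum0 : (xsum C (set0 : {set 'I_n}))%:F = 0 :> K.
Proof. by rewrite /xsum big_set0 tofrac0. Qed.

Lemma du_xsum_subl (X : {set 'I_n}) :
  X \subset I -> du (xsum C X)%:F = al * (xsum C X)%:F.
Proof.
move=> XI; rewrite du_xsum (setIidPr XI).
have /eqP-> : J :&: X == set0.
  by rewrite setI_eq0 disjoint_sym (disjointWl XI).
by rewrite xsum0 mulr0 addr0.
Qed.

Lemma du_xsum_subr (X : {set 'I_n}) :
  X \subset J -> du (xsum C X)%:F = be * (xsum C X)%:F.
Proof.
move=> XJ; rewrite du_xsum (setIidPr XJ).
have /eqP-> : I :&: X == set0 by rewrite setI_eq0 (disjointWr XJ).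
by rewrite xsum0 mulr0 add0r.
Qed.

(** In the first case the value is al x_I + be x_J = 0; in the second both Euler operators kill
    x_X. *)
Lemma du_xsum_large (X : {set 'I_n}) :
  (I :|: J \subset X) || [disjoint I :|: J & X] ->
  du (xsum C X)%:F = 0.
Proof.
rewrite du_xsum => /orP[].
  rewrite subUset => /andP[/setIidPl-> /setIidPl->].
  exact: alabe.
rewrite -setI_eq0 setIUl setU_eq0 => /andP[/eqP-> /eqP->].
by rewrite xsum0 !mulr0 addr0.
Qed.

Lemma uvarE (X Y : {set 'I_n}) : uvar C X Y =
  ((xsum C Y)%:F - (xsum C X)%:F) / ((xsum C X)%:F + (xsum C Y)%:F).
Proof. by rewrite /uvar tofracB tofracD. Qed.

Let ds : du (a + b) = 0.
Proof. by rewrite -(tofrac_xsumU dIJ); apply: du_xsum_large; rewrite subxx. Qed.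

Lemma du_uvar : du (uvar C I J) = 1.
Proof.
rewrite uvarE; apply: (der_jacobi_variable duD duM two0 s0 _ _ ala2 beb2).
- exact: du_xsum_subl.
- exact: du_xsum_subr.
Qed.

(** In the three cases x_X and x_Y are eigenvectors of [du] with the same eigenvalue: [al], [be] and
    0 respectively. *)
Lemma du_uvar0 (X Y : {set 'I_n}) : X :|: Y != set0 -> [disjoint X & Y] ->
  [\/ X :|: Y \subset I, X :|: Y \subset J |
    ((I :|: J \subset X) || [disjoint I :|: J & X]) &&
    ((I :|: J \subset Y) || [disjoint I :|: J & Y])] ->
  du (uvar C X Y) = 0.
Proof.
move=> nzXY dXY lam; rewrite uvarE.
have nz : (xsum C X)%:F + (xsum C Y)%:F != 0 :> K.
  by rewrite -(tofrac_xsumU dXY) tofrac_eq0 xsum_neq0.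
case: lam => [|| /andP[lX lY]].
- rewrite subUset => /andP[XI YI].
  by apply: (der_eigenratio duD duM nz) => //; rewrite du_xsum_subl.
- rewrite subUset => /andP[XJ YJ].
  by apply: (der_eigenratio duD duM nz) => //; rewrite du_xsum_subr.
- apply: (der_eigenratio (c := 0) duD duM nz);
  by rewrite du_xsum_large ?mul0r.
Qed.

(** The terms in - al^2 and - be^2 come from differentiating the coefficients [al] and [be]
    themselves. *)
Lemma du2_tofrac p : du (du p%:F) =
  - al ^+ 2 * (euler I p)%:F +
     al * (al * (euler I (euler I p))%:F + be * (euler J (euler I p))%:F) +
  (- be ^+ 2 * (euler J p)%:F +
     be * (al * (euler I (euler J p))%:F + be * (euler J (euler J p))%:F)).
Proof.
have dal : du al = - al ^+ 2.
  apply: (der_eigenvalue duD duM two0 a0 ala2); last exact: du_xsum_subl.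
  by rewrite (derN duD) ds oppr0.
have dbe : du be = - be ^+ 2.
  by apply: (der_eigenvalue duD duM two0 b0 beb2 ds); exact: du_xsum_subr.
rewrite [du p%:F]du_tofrac duD !duM dal dbe.
by rewrite (du_tofrac (euler I p)) (du_tofrac (euler J p)).
Qed.

Variable lam : 'I_n -> C.

Lemma casimir'_jacobi p (u := uvar C I J) :
  (casimir'_of lam (I :|: J) p)%:F =
  (u ^+ 2 - 1) * du (du p%:F) +
    (((lam_of lam I - lam_of lam J)%:MP)%:F +
      ((lam_of lam I + lam_of lam J)%:MP)%:F * u) * du p%:F
  + 2 / (1 - u) * (casimir'_of lam I p)%:F
  + 2 / (1 + u) * (casimir'_of lam J p)%:F.
Proof.
rewrite du2_tofrac du_tofrac !casimir'_euler deltaU // lam_ofU // xsumU //.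
rewrite !eulerU // !eulerD.
rewrite !(tofracD, tofracM, mpolyCD, mpolyCN, tofracN, mpolyC1, tofrac1).
rewrite /u uvarE.
exact (jacobi_identity _ _ _ _ _ _ _ _ _ _ two0 a0 b0 s0 ala2 beb2).
Qed.

End JacobiVariable.

(** [casimir'_jacobi] gives the formula with [du]; the chain rule then turns [du] into the partial
    derivative of [P] in the variable of step [k]. *)
Lemma casimir'_of_step (C : numFieldType) (n : nat)
    (lam : 'I_n -> C) (G : (n.-1).-tuple ({set 'I_n} * {set 'I_n}))
    (hG : coupling_scheme G) (k : 'I_n.-1)
    (p : {mpoly C[n]}) (P : {mpoly C[(n.-1).+1]})
    (hP : expressed_as G p P) :
  let I := (tnth G k).1 in
  let J := (tnth G k).2 in
  let u := uvar C I J in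
  (casimir'_of lam (I :|: J) p)%:F =
    at_new_coord G (jacobi (lam_of lam I) (lam_of lam J) (lift ord0 k) P)
    + 2 / (1 - u) * (casimir'_of lam I p)%:F
    + 2 / (1 + u) * (casimir'_of lam J p)%:F.
Proof.
move=> I J u; have [dIJ nI nJ] := scheme_blocks k hG.
have [|||al [be [ala beb]]] :=
  @jacobi_coefs {fraction {mpoly C[n]}} (xsum C I)%:F (xsum C J)%:F.
- exact: frac_mpoly_two_neq0.
- by rewrite tofrac_eq0 xsum_neq0.
- by rewrite tofrac_eq0 xsum_neq0.
pose const : {rmorphism C -> {fraction {mpoly C[n]}}} :=
  (@tofrac _ \o @mpolyC n C)%FUN.
have dnc j : du I J al be (new_coord C G j) = (lift ord0 k == j)%:R.
  (* Coordinate [ord0] is the total sum, killed because its index set contains I and J; the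
     variables of the other steps are killed by nestedness. *)
  rewrite /new_coord; case: unliftP => [l ->|->]; last first.
    by rewrite eq_sym (negPf (neq_lift _ _)) du_xsum_large ?subsetT.
  rewrite (inj_eq lift_inj); have [<-|lk] := eqVneq k l; first exact: du_uvar.
  have [dXY nX _] := @scheme_blocks n G l hG.
  apply: du_uvar0 => //; last first.
    by apply: (@scheme_laminar n G k hG l); rewrite eq_sym.
  by apply: contraNneq nX => U0; rewrite -subset0 -U0 subsetUl.
have ev P' :
    du I J al be (at_new_coord G P') = at_new_coord G P'^`M(lift ord0 k).
  exact: (mmap_mderiv (f := const) (duD I J al be) (duM I J al be)
    (@du_const _ _ I J al be) dnc).
rewrite (casimir'_jacobi dIJ nI nJ ala beb) hP !ev; congr (_ + _ + _).
rewrite /jacobi.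
have evX : at_new_coord G 'X_(lift ord0 k) = uvar C I J.
  (* Restating the evaluation with the bundled morphism [const] makes the morphism lemmas for [mmap]
     applicable. *)
  rewrite -[LHS]/(mmap const (new_coord C G) _) mmapX mmap1U.
  by rewrite /new_coord liftK.
rewrite -[RHS]/(mmap const (new_coord C G) _).
rewrite mmapD !rmorphM /= mmapB rmorphXn /= mmapD mmapZ mmapC rmorph1.
by rewrite [mmap const _ 'X_ _]evX.
Qed.

Theorem proposition5p3 (R : realType) (n : nat) (hn : (3 <= n)%N)
    (lam : 'I_n -> R[i]) (G : (n.-1).-tuple ({set 'I_n} * {set 'I_n}))
    (hG : coupling_scheme G) (k : 'I_n.-1)
    (p : {mpoly R[i][n]}) (P : {mpoly R[i][(n.-1).+1]})
    (hP : expressed_as G p P) :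
  let I := (tnth G k).1 in
  let J := (tnth G k).2 in
  let u := uvar R[i] I J in
  (casimir'_of lam (I :|: J) p)%:F =
    at_new_coord G (jacobi (lam_of lam I) (lam_of lam J) (lift ord0 k) P)
    + 2 / (1 - u) * (casimir'_of lam I p)%:F
    + 2 / (1 + u) * (casimir'_of lam J p)%:F.
Proof. exact: casimir'_of_step. Qed.
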